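(* Let $X,Y$ be real Banach spaces, $A\subseteq X$ a nonempty compact convex set, $C\subseteq Y$ a closed convex cone with nonempty interior, and $F:X\to Y$ a continuous linear map with $F(X)\cap\operatorname{int}C\neq\emptyset$. Let $\theta$ be the associated merit function, assumed to satisfy $\theta(x)<+\infty$ for all $x\in X$. Then for any $x\in A$, $$x\in E_w\iff \theta'(x;d)\ge0\quad\forall d\in T_A(x).$$
   Context: $d_D(y)=\inf_{u\in D}\|y-u\|$ with $d_\emptyset\equiv+\infty$; $\Delta_D(y)=d_D(y)-d_{Y\setminus D}(y)$ with conventions $\Delta_\emptyset\equiv+\infty$, $\Delta_Y\equiv-\infty$. $C^+=\{y^*\in Y^*:\langle y^*,c\rangle\ge 0\ \forall c\in C\}$, $S(C^+)=\{y^*\in C^+:\|y^*\|=1\}$. The merit function is $$\theta(x)=\sup_{a\in A}\bigl(-\Delta_C(F(x)-F(a))\bigr)=\sup_{a\in A}\inf_{y^*\in S(C^+)}\langle y^*,F(x)-F(a)\rangle .$$ $E_w=\{\bar x\in A: F(\bar x)\notin F(A)+\operatorname{int}C\}$ is the weakly efficient solution set. $T_A(x)=\{d\in X:\exists t_k\downarrow0,\ \exists d_k\to d,\ x+t_kd_k\in A\}$ is the tangent cone. $\theta'(x;d)=\lim_{t\downarrow0}\frac{\theta(x+td)-\theta(x)}{t}$, which exists and is finite since $\theta$ is concave and Lipschitz. *)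

(* Defs.v *)
From mathcomp Require Import all_boot all_order all_algebra.
From mathcomp Require Import all_classical all_reals all_analysis.
Import Order.TTheory GRing.Theory Num.Theory.
Import numFieldNormedType.Exports.

Set Implicit Arguments.
Unset Strict Implicit.
Unset Printing Implicit Defensive.

Local Open Scope classical_set_scope.
Local Open Scope ring_scope.

(* For a closed nonempty set, allowing t = 0 or requiring t > 0 is the same. *)
Definition cone (R : realType) (V : lmodType R) (C : set V) : Prop :=
  forall (t : R) (c : V), 0 <= t -> C c -> C (t *: c).

(* Extended-real valued; the infimum over the empty set is +oo. *)
Definition dist_set (R : realType) (Y : normedModType R) (D : set Y) (y : Y)
    : \bar R :=
  ereal_inf [set `|y - u|%:E | u in D].

Definition oriented_dist (R : realType) (Y : normedModType R) (D : set Y)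
    (y : Y) : \bar R :=
  (dist_set D y - dist_set (~` D) y)%E.

Lemma dist_set0 (R : realType) (Y : normedModType R) (y : Y) :
  dist_set set0 y = +oo%E.
Proof. by rewrite /dist_set image_set0 ereal_inf0. Qed.

Lemma dist_setT (R : realType) (Y : normedModType R) (y : Y) :
  dist_set setT y = 0%E.
Proof.
apply/eqP; rewrite eq_le; apply/andP; split.
  by apply: ereal_inf_lbound; exists y; rewrite ?subrr ?normr0.
by apply: le_ereal_inf_tmp => _ [u _ <-]; rewrite lee_fin.
Qed.

Lemma oriented_dist0 (R : realType) (Y : normedModType R) (y : Y) :
  oriented_dist set0 y = +oo%E.
Proof. by rewrite /oriented_dist dist_set0 setC0 dist_setT sube0. Qed.

Lemma oriented_distT (R : realType) (Y : normedModType R) (y : Y) :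
  oriented_dist setT y = -oo%E.
Proof. by rewrite /oriented_dist setCT dist_set0 dist_setT sub0e. Qed.

Definition merit (R : realType) (X Y : normedModType R) (A : set X) (C : set Y)
    (F : X -> Y) (x : X) : \bar R :=
  ereal_sup [set (- oriented_dist C (F x - F a)%R)%E | a in A].

Definition weakly_efficient (R : realType) (X Y : normedModType R) (A : set X)
    (C : set Y) (F : X -> Y) : set X :=
  [set x | A x /\ ~ [set F a + c | a in A & c in C^°] (F x)].

Definition tangent_cone (R : realType) (X : normedModType R) (A : set X)
    (x : X) : set X :=
  [set d | exists (t : nat -> R) (d_ : nat -> X),
    [/\ forall k, 0 < t k, t @ \oo --> 0, d_ @ \oo --> d &
        forall k, A (x + t k *: d_ k)]].

(* lim is total: the value is meaningful only when the quotient converges, as it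
   does (to a finite limit) when f is finite, concave and Lipschitz. *)
Definition dir_derive (R : realType) (X : normedModType R) (f : X -> \bar R)
    (x d : X) : \bar R :=
  lim (((f (x + t *: d)%R - f x) * (t^-1)%:E)%E @[t --> 0^'+]).

(* Main.v *)
(* Let g := - Delta_C be the real-valued signed depth in C. Superlinearity of g
   (convexity of C) makes theta(x) = sup_a g(F x - F a) concave, so its
   difference quotients are nonincreasing in t and the directional derivative is
   their supremum over t > 0. If x is weakly efficient, theta vanishes at x and
   is nonnegative at x + t_k d_k; superadditivity and g(y) >= - |y| then give
   quotients at t_k at least - |F (d_k - d)|, which tends to 0. Conversely, for
   a in A superadditivity gives theta(x + t (a - x)) <= theta(x) - t g(F x - F a),
   so the derivative in the tangent direction a - x is at most - g(F x - F a);
   nonnegativity for every a says that theta(x) <= 0. *)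
Require Import Defs.
From mathcomp Require Import all_boot all_order all_algebra.
From mathcomp Require Import all_classical all_reals all_analysis.
From mathcomp Require Import lra.
Import Order.TTheory GRing.Theory Num.Theory.
Import numFieldNormedType.Exports.

Set Implicit Arguments.
Unset Strict Implicit.
Unset Printing Implicit Defensive.

Local Open Scope classical_set_scope.
Local Open Scope ring_scope.

(** * Convex sets and cones *)

Lemma convex_setP (R : numDomainType) (M : lmodType R) (A : set M) (a b : M)
    (t : R) :
  convex_set A -> A a -> A b -> 0 <= t -> t <= 1 ->
  A (t *: a + (1 - t) *: b).
Proof.
move=> cA Aa Ab t0 t1.
by have := cA a b (Itv01 t0 t1) (mem_set Aa) (mem_set Ab); rewrite inE.
Qed.

(** The sum is twice the midpoint. *)
Lemma convex_coneD (R : realType) (V : lmodType R) (C : set V) (a b : V) :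
  convex_set C -> cone C -> C a -> C b -> C (a + b).
Proof.
move=> cvxC coneC Ca Cb.
have h0 : (0 : R) <= 2^-1 by lra.
have h1 : (2^-1 : R) <= 1 by lra.
have := coneC 2 _ (ler0n _ _) (convex_setP cvxC Ca Cb h0 h1).
rewrite scalerDr !scalerA divff// mulrBr divff// mulr1.
by rewrite (_ : 2 - 1 = 1 :> R) ?scale1r//; lra.
Qed.

Lemma coneZ_inv (R : realType) (V : lmodType R) (C : set V) (t : R) (y : V) :
  cone C -> 0 < t -> C (t *: y) -> C y.
Proof.
move=> coneC t0 /(coneC t^-1 (t *: y) _).
by rewrite scalerA mulVf ?gt_eqF// scale1r; apply; rewrite invr_ge0 ltW.
Qed.

(** * Real-valued distance to a nonempty set *)

Definition rdist (R : realType) (Y : normedModType R) (D : set Y) (y : Y) : R :=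
  fine (dist_set D y).

Section rdist.
Variables (R : realType) (Y : normedModType R) (D : set Y).
Hypothesis D0 : D !=set0.
Implicit Types (y u : Y) (r t : R).

Lemma rdistE y : dist_set D y = (rdist D y)%:E.
Proof.
have [u Du] := D0.
rewrite /rdist fineK// ge0_fin_numE.
  apply: (@le_lt_trans _ _ `|y - u|%:E); last exact: ltry.
  by apply: ereal_inf_lbound; exists u.
by apply: le_ereal_inf_tmp => _ [v _ <-]; rewrite lee_fin.
Qed.

Lemma rdist_le y u : D u -> rdist D y <= `|y - u|.
Proof.
by move=> Du; rewrite -lee_fin -rdistE; apply: ereal_inf_lbound; exists u.
Qed.

Lemma rdist_ge y r : (forall u, D u -> r <= `|y - u|) -> r <= rdist D y.
Proof.
move=> H; rewrite -lee_fin -rdistE; apply: le_ereal_inf_tmp => _ [u Du <-].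
by rewrite lee_fin H.
Qed.

Lemma rdist_lt y r : rdist D y < r -> exists2 u, D u & `|y - u| < r.
Proof.
rewrite -lte_fin -rdistE => /ereal_inf_lt[_ [u Du <-]].
by rewrite lte_fin => ?; exists u.
Qed.

Lemma rdist_ge0 y : 0 <= rdist D y.
Proof. exact: rdist_ge. Qed.

Lemma rdist_mem y : D y -> rdist D y = 0.
Proof.
move=> Dy; apply/le_anti/andP; split; last exact: rdist_ge0.
by rewrite -(normr0 Y) -(subrr y) rdist_le.
Qed.

(** The closure condition has a form that both a cone and its complement satisfy, so [depthZ_ge] can
    apply it to each. *)
Lemma rdistZ_ge t y : (forall u, D (t *: u) -> D u) -> 0 < t ->
  t * rdist D y <= rdist D (t *: y).
Proof.
move=> Dt t0; apply: rdist_ge => u Du.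
have -> : u = t *: (t^-1 *: u) by rewrite scalerA divff ?gt_eqF// scale1r.
rewrite -scalerBr normrZ gtr0_norm// ler_pM2l// rdist_le//.
by apply: Dt; rewrite scalerA divff ?gt_eqF// scale1r.
Qed.

End rdist.

(** * Signed depth in a convex cone: homogeneity and superadditivity *)

Definition depth (R : realType) (Y : normedModType R) (C : set Y) (y : Y) : R :=
  rdist (~` C) y - rdist C y.

Section depth.
Variables (R : realType) (Y : normedModType R) (C : set Y).
Hypotheses (C0 : C !=set0) (CT : ~` C !=set0).
Implicit Types (y z : Y) (t : R).

Lemma depthE y : (- oriented_dist C y)%E = (depth C y)%:E.
Proof. by rewrite /oriented_dist !rdistE// -EFinB -EFinN opprB. Qed.

Lemma depth_gt0 y : 0 < depth C y <-> C° y.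
Proof.
split=> [/lt_le_trans h|/nbhs_ballP[e /= e0 yeC]].
  have {}h : 0 < rdist (~` C) y by apply: h; rewrite /depth gerBl rdist_ge0.
  apply/nbhs_ballP; exists (rdist (~` C) y) => //= u.
  rewrite -ball_normE /= => yu; apply: contrapT => Cu.
  by move: yu; rewrite ltNge rdist_le.
rewrite /depth (@rdist_mem _ _ C)// ?subr0; last exact/yeC/ballxx.
apply: (lt_le_trans e0); apply: rdist_ge => // u Cu.
rewrite leNgt; apply/negP => ue; apply: Cu; apply: yeC.
by rewrite -ball_normE.
Qed.

Hypothesis coneC : cone C.

Lemma cone_mem0 : C 0.
Proof. by case: C0 => c Cc; rewrite -(scale0r c); apply: coneC. Qed.

Lemma depthZ_ge t y : 0 < t -> t * depth C y <= depth C (t *: y).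
Proof.
move=> t0.
have h : t * rdist (~` C) y <= rdist (~` C) (t *: y).
  by apply: rdistZ_ge => // u Cu /(coneC (ltW t0)).
have k : t^-1 * rdist C (t *: y) <= rdist C y.
  have := @rdistZ_ge _ _ _ C0 t^-1 (t *: y).
  rewrite scalerA mulVf ?gt_eqF// scale1r; apply; last by rewrite invr_gt0.
  by move=> u; apply: coneZ_inv; rewrite ?invr_gt0.
rewrite mulrBr lerB//.
by rewrite -(ler_pM2l (_ : 0 < t^-1)) ?invr_gt0// mulrA mulVf ?gt_eqF// mul1r.
Qed.

(** The reverse inequality is [depthZ_ge] for [t^-1] at [t *: y]. *)
Lemma depthZ t y : 0 < t -> depth C (t *: y) = t * depth C y.
Proof.
move=> t0; apply/le_anti/andP; split; last exact: depthZ_ge.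
have := @depthZ_ge t^-1 (t *: y).
rewrite invr_gt0 scalerA mulVf ?gt_eqF// scale1r => /(_ t0).
by rewrite ler_pdivrMl.
Qed.

Lemma depth_ge_normN y : - `|y| <= depth C y.
Proof.
have h := rdist_le C0 y cone_mem0.
by have := rdist_ge0 CT y; rewrite subr0 in h; rewrite /depth; lra.
Qed.

Lemma depth0_ge0 : 0 <= depth C 0.
Proof. by have := depth_ge_normN 0; rewrite normr0 oppr0. Qed.

Hypothesis cvxC : convex_set C.

(* Allows a zero distance, where y may lie on the boundary and the open ball of
   that radius is empty. *)
Let scaled_mem y w s : C y -> 0 < s -> `|w| < s ->
  C (y + (rdist (~` C) y / s) *: w).
Proof.
set p := rdist _ _ => Cy s0 ws; apply: contrapT => nC.
have := rdist_le CT y nC.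
rewrite -/p opprD addNKr normrN normrZ.
have p0 : 0 <= p by exact: rdist_ge0.
rewrite ger0_norm; last by rewrite divr_ge0// ltW.
rewrite mulrAC ler_pdivlMr//.
have [p1|p1] : p = 0 \/ 0 < p by lra.
  by move: nC; rewrite p1 mul0r scale0r addr0.
by rewrite ler_pM2l// leNgt ws.
Qed.

(** If [u] is closer than [p + q] to [y + z], the displacement is split in the ratio [p : q] between
    [y] and [z]; by [scaled_mem] both shifted points stay in [C], and they add up to [u]. *)
Let depthD_in y z : C y -> C z -> depth C y + depth C z <= depth C (y + z).
Proof.
move=> Cy Cz; have Cyz := convex_coneD cvxC coneC Cy Cz.
rewrite /depth (@rdist_mem _ _ C _ y)// (@rdist_mem _ _ C _ z)//.
rewrite (@rdist_mem _ _ C _ (y + z))// !subr0.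
set p := rdist _ y; set q := rdist _ z.
apply: rdist_ge => // u Cu; rewrite leNgt; apply/negP; rewrite distrC => upq.
have s0 := le_lt_trans (normr_ge0 _) upq; apply: Cu.
have := convex_coneD cvxC coneC (scaled_mem Cy s0 upq)
  (scaled_mem Cz s0 upq).
rewrite addrACA -scalerDl -mulrDl divff ?gt_eqF// scale1r.
by rewrite [_ + (u - _)]addrC subrK.
Qed.

(** With [c] in [C] almost closest to [z], the point [y] absorbs as much of the displacement [z - c]
    as its depth [p] allows. *)
Let depthD_mix y z : C y -> ~ C z -> depth C y + depth C z <= depth C (y + z).
Proof.
move=> Cy Cz.
rewrite {1 2}/depth (@rdist_mem _ _ C _ y)// (@rdist_mem _ _ (~` C) _ z)//.
rewrite subr0 sub0r; set p := rdist _ y.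
(* The slack [e] stands in for a nearest point of [C], which may not exist. *)
apply/ler_addgt0Pr => e e0; set s := rdist C z + e.
suff : p - s <= depth C (y + z) by rewrite /s; lra.
have /rdist_lt[//|c Cc zcs] : rdist C z < s by rewrite ltrDl.
have s0 := le_lt_trans (normr_ge0 _) zcs.
have Cyw := scaled_mem Cy s0 zcs.
rewrite -/p in Cyw.
(* If [p <= s], the fraction [p / s] of [z - c] is absorbed and the rest bounds the distance of
   [y + z] to [C]. Otherwise all of it is absorbed, leaving a ball of radius [p - s] around [y + z]
   inside [C]. *)
have [ps|sp] := lerP p s.
  have h : rdist C (y + z) <= s - p.
    have := rdist_le C0 (y + z) (convex_coneD cvxC coneC Cyw Cc).
    move=> /le_trans; apply.
    have -> : y + z - (y + (p / s) *: (z - c) + c) = (1 - p / s) *: (z - c).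
      rewrite scalerBl scale1r -(addrA y _ c) opprD addrACA subrr add0r.
      by rewrite opprD addrCA addrC.
    have h1 : 0 <= 1 - p / s by rewrite subr_ge0 ler_pdivrMr// mul1r.
    rewrite normrZ ger0_norm//.
    apply: (le_trans (ler_wpM2l h1 (ltW zcs))).
    by rewrite mulrBl mul1r divfK ?gt_eqF.
  by have := rdist_ge0 CT (y + z); rewrite /depth; lra.
have pB w : `|w| < p -> C (y + w).
  move=> wp; have := scaled_mem Cy (lt_trans s0 sp) wp.
  by rewrite -/p divff ?scale1r// gt_eqF// (lt_trans s0 sp).
have Cyz : C (y + z).
  have -> : y + z = (y + (z - c)) + c by rewrite addrA subrK.
  by apply: convex_coneD => //; apply: pB; apply: lt_trans sp.
rewrite /depth (@rdist_mem _ _ C _ (y + z))// subr0.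
apply: rdist_ge => // u Cu; rewrite leNgt; apply/negP; rewrite distrC => ups.
apply: Cu.
have -> : u = (y + ((u - (y + z)) + (z - c))) + c.
  by rewrite !addrA subrK opprD !addrA subrK [y + u]addrC addrK.
apply: convex_coneD => //; apply: pB.
by apply: le_lt_trans (ler_normD _ _) _; lra.
Qed.

Lemma depthD y z : depth C y + depth C z <= depth C (y + z).
Proof.
have [Cy|Cy] := pselect (C y); have [Cz|Cz] := pselect (C z).
- exact: depthD_in.
- exact: depthD_mix.
- by rewrite addrC [y + z]addrC; exact: depthD_mix.
rewrite {1 2}/depth (@rdist_mem _ _ (~` C) _ y)// (@rdist_mem _ _ (~` C) _ z)//.
rewrite !sub0r -opprD.
(* Outside [C] the depth is minus the distance to [C], which is subadditive because almost closest
   points add up within [C]. *)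
suff h : rdist C (y + z) <= rdist C y + rdist C z.
  by have := rdist_ge0 CT (y + z); rewrite /depth; lra.
apply/ler_addgt0Pr => e e0.
have e2 : 0 < e / 2 by lra.
have /rdist_lt[//|a Ca ya] : rdist C y < rdist C y + e / 2 by rewrite ltrDl.
have /rdist_lt[//|b Cb zb] : rdist C z < rdist C z + e / 2 by rewrite ltrDl.
have := rdist_le C0 (y + z) (convex_coneD cvxC coneC Ca Cb).
rewrite opprD addrACA => /le_trans; apply.
by apply: le_trans (ler_normD _ _) _; lra.
Qed.

End depth.

(** * The merit function: concavity and directional derivative *)

Definition rmerit (R : realType) (X Y : normedModType R) (A : set X)
  (C : set Y) (F : X -> Y) (x : X) : R := fine (merit A C F x).

Definition diff_quot (R : realType) (X : normedModType R) (f : X -> R)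
  (x d : X) (t : R) : R := (f (x + t *: d) - f x) / t.

Section merit.
Variables (R : realType) (X Y : normedModType R) (A : set X) (C : set Y).
Variable F : {linear X -> Y}.
Hypotheses (A0 : A !=set0) (C0 : C !=set0).
Hypothesis merit_fin : forall x : X, (merit A C F x < +oo)%E.
Implicit Types (x a d : X) (r s t : R).

(** If [C] were the whole space, every term of the supremum would be [+oo]. *)
Lemma merit_fin_setC : ~` C !=set0.
Proof.
apply/set0P/negP => /eqP CT; have [a Aa] := A0.
have := merit_fin a; rewrite ltNge => /negP; apply.
apply: ereal_sup_ubound; exists a => //.
by rewrite -(setCK C) CT setC0 oriented_distT.
Qed.

Let CT := merit_fin_setC.

Lemma meritE x : merit A C F x = (rmerit A C F x)%:E.
Proof.
have [a Aa] := A0; rewrite /rmerit fineK//.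
rewrite fin_numElt merit_fin andbT.
apply: (@lt_le_trans _ _ (depth C (F x - F a))%:E); first exact: ltNyr.
by rewrite -depthE//; apply: ereal_sup_ubound; exists a.
Qed.

Lemma rmerit_ge x a : A a -> depth C (F x - F a) <= rmerit A C F x.
Proof.
move=> Aa; rewrite -lee_fin -meritE -depthE//.
by apply: ereal_sup_ubound; exists a.
Qed.

Lemma rmerit_le x r : (forall a, A a -> depth C (F x - F a) <= r) ->
  rmerit A C F x <= r.
Proof.
move=> h; rewrite -lee_fin -meritE; apply: ge_ereal_sup => _ [a Aa <-].
by rewrite depthE// lee_fin h.
Qed.

Hypotheses (coneC : cone C) (cvxC : convex_set C).

Lemma rmerit_ge0 x : A x -> 0 <= rmerit A C F x.
Proof.
move=> Ax; apply: le_trans (rmerit_ge x Ax).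
by rewrite subrr depth0_ge0.
Qed.

(** By [depth_gt0], [F x - F a] is interior to [C] exactly when its term in the supremum is
    positive. *)
Lemma weakly_efficientP x : A x ->
  weakly_efficient A C F x <-> rmerit A C F x <= 0.
Proof.
move=> Ax; split=> [[_ h]|h].
  apply: rmerit_le => a Aa; rewrite leNgt; apply/negP => /(depth_gt0 C0 CT) Ca.
  by apply: h; exists a => //; exists (F x - F a) => //; rewrite addrC subrK.
split=> // -[a Aa [c /(depth_gt0 C0 CT) Cc Fx]].
have := le_trans (rmerit_ge x Aa) h.
by rewrite -Fx addrAC subrr add0r leNgt Cc.
Qed.

(** Superadditivity applied to [F (x + v) - F a] and [- F v]. Both directions of the theorem rest on
    this bound. *)
Lemma rmerit_shift_le x v : rmerit A C F (x + v) <=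
  rmerit A C F x - depth C (- F v).
Proof.
apply: rmerit_le => a Aa; rewrite lerBrDr.
apply: le_trans (depthD C0 CT coneC cvxC _ _) _.
by rewrite linearD addrAC addrK rmerit_ge.
Qed.

Hypothesis cvxA : convex_set A.

Lemma rmerit_concave x y t : 0 < t -> t < 1 ->
  t * rmerit A C F x + (1 - t) * rmerit A C F y <=
  rmerit A C F (t *: x + (1 - t) *: y).
Proof.
move=> t0 t1; have t1' : 0 < 1 - t by rewrite subr_gt0.
(* Each merit value is isolated in turn, so that its supremum can be bounded term by term. *)
rewrite -lerBrDr -ler_pdivlMl//; apply: rmerit_le => a Aa.
rewrite ler_pdivlMl// lerBrDr addrC -lerBrDr -ler_pdivlMl//.
apply: rmerit_le => b Ab; rewrite ler_pdivlMl// lerBrDr addrC.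
rewrite -!depthZ//.
apply: le_trans (depthD C0 CT coneC cvxC _ _) _.
have := rmerit_ge (t *: x + (1 - t) *: y)
  (convex_setP cvxA Aa Ab (ltW t0) (ltW t1)).
by rewrite !(linearD F) !linearZ_LR /= opprD addrACA -!scalerBr.
Qed.

(** Concavity at [x + s *: d], which divides the segment from [x] to [x + t *: d] with weight
    [s / t]. *)
Lemma diff_quot_rmerit_nincr x d s t : 0 < s -> s <= t ->
  diff_quot (rmerit A C F) x d t <= diff_quot (rmerit A C F) x d s.
Proof.
move=> s0; rewrite le_eqVlt => /predU1P[->//|st].
have t0 := lt_trans s0 st.
have k1 : s / t < 1 by rewrite ltr_pdivrMr// mul1r.
have := rmerit_concave (x + t *: d) x (divr_gt0 s0 t0) k1.
have -> : (s / t) *: (x + t *: d) + (1 - s / t) *: x = x + s *: d.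
  rewrite scalerDr scalerA divfK ?gt_eqF// addrAC -scalerDl addrC.
  by rewrite [s / t + _]addrC subrK scale1r addrC.
move=> h; rewrite /diff_quot ler_pdivlMr// -mulrA [_^-1 * s]mulrC.
by rewrite mulrBl; lra.
Qed.

(** Monotonicity of the quotients makes the limit exist in the extended reals, so [lim] does not
    return a default value here. *)
Lemma dir_derive_merit x d :
  dir_derive (merit A C F) x d =
  ereal_sup [set (diff_quot (rmerit A C F) x d t)%:E | t in `]0, +oo[].
Proof.
rewrite /dir_derive; apply: cvg_lim => //.
under eq_fun do rewrite !meritE -EFinB -EFinM.
apply: (@nonincreasing_at_right_cvge _ _ 0 +oo%O) => // s t.
rewrite !in_itv /= !andbT => s0 t0 st.
by rewrite lee_fin; exact: diff_quot_rmerit_nincr.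
Qed.

Lemma dir_derive_merit_ge x d t : 0 < t ->
  ((diff_quot (rmerit A C F) x d t)%:E <= dir_derive (merit A C F) x d)%E.
Proof.
move=> t0; rewrite dir_derive_merit; apply: ereal_sup_ubound; exists t => //=.
by rewrite in_itv /= t0.
Qed.

Lemma dir_derive_merit_ge0 x d : continuous F -> A x -> rmerit A C F x <= 0 ->
  tangent_cone A x d -> (0 <= dir_derive (merit A C F) x d)%E.
Proof.
move=> F_cont Ax hx [t [d_ [t0 _ cvgd At]]].
apply/lee_addgt0Pr => e e0.
have cvgF : F (d_ k - d) @[k --> \oo] --> (0 : Y).
  rewrite -(linear0 F) -(subrr d).
  apply: cvg_comp; last exact: F_cont.
  by apply: cvgB => //; exact: cvg_cst.
have F0e : `|0 : Y| < e by rewrite normr0.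
have [k _ /(_ k (leqnn k)) /= Fk] := cvgr_norm_lt _ cvgF _ F0e.
(* One index [k] suffices for each [e], since the derivative dominates every quotient. *)
apply: le_trans (leeD (dir_derive_merit_ge x d (t0 k)) (lexx _)).
rewrite -EFinD lee_fin -lerBlDr sub0r ler_pdivlMr// mulNr mulrC.
(* The shift leads from [x + t k *: d] to the point [x + t k *: d_ k] of [A], where the merit is
   nonnegative, at a cost below [t k * e]. *)
have := rmerit_shift_le (x + t k *: d) (t k *: (d_ k - d)).
rewrite scalerBr addrA addrAC addrK => /(le_trans (rmerit_ge0 (At k))).
have := depth_ge_normN C0 CT coneC (- F (t k *: d_ k - t k *: d)).
rewrite normrN -scalerBr linearZ_LR normrZ gtr0_norm//.
by have := ler_wpM2l (ltW (t0 k)) (ltW Fk); lra.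
Qed.

Lemma dir_derive_merit_le x a : A x ->
  (dir_derive (merit A C F) x (a - x)%R <= (- depth C (F x - F a))%:E)%E.
Proof.
move=> Ax; rewrite dir_derive_merit; apply: ge_ereal_sup.
move=> _ [t + <-]; rewrite /= in_itv /= andbT => t0; rewrite lee_fin ler_pdivrMr// lerBlDl.
apply: le_trans (rmerit_shift_le _ _) _; rewrite mulNr.
by rewrite -linearN -scalerN linearZ /= depthZ// opprB linearB mulrC.
Qed.

Lemma tangent_coneB x a : A x -> A a -> tangent_cone A x (a - x).
Proof.
(* The steps [1 / (k + 1)] are positive and at most 1, which keeps the points on the segment from
   [x] to [a]. *)
move=> Ax Aa; exists (fun k => k.+1%:R^-1), (fun=> a - x); split => //.
- exact: cvg_harmonic.
- exact: cvg_cst.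
move=> k; have k0 : (0 : R) <= k.+1%:R^-1 by [].
have k1 : (k.+1%:R^-1 : R) <= 1 by rewrite invf_le1// ler1n.
have := convex_setP cvxA Aa Ax k0 k1.
by rewrite scalerBl scale1r scalerBr addrCA.
Qed.

End merit.

Unset Implicit Arguments.
Set Strict Implicit.
Set Printing Implicit Defensive.

Theorem theorem5p4 (R : realType) (X Y : completeNormedModType R)
    (A : set X) (C : set Y) (F : {linear X -> Y})
    (A_neq0 : A !=set0) (A_compact : compact A) (A_convex : convex_set A)
    (C_closed : closed C) (C_convex : convex_set C) (C_cone : cone C)
    (C_int : C^° !=set0)
    (F_cont : continuous F) (F_int : range F `&` C^° !=set0)
    (merit_fin : forall x : X, (merit A C F x < +oo)%E)
    (x : X) (Ax : A x) :
  weakly_efficient A C F x <->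
  (forall d : X, tangent_cone A x d -> (0 <= dir_derive (merit A C F) x d)%E).
Proof.
have C0 : C !=set0 by case: C_int => c /interior_subset; exists c.
have CT := merit_fin_setC A_neq0 merit_fin.
rewrite (weakly_efficientP A_neq0 C0 merit_fin Ax).
split=> [h d|h]; first exact: dir_derive_merit_ge0.
apply: (rmerit_le A_neq0 C0 merit_fin) => a Aa.
rewrite -oppr_ge0 -lee_fin.
apply: le_trans (h _ (tangent_coneB A_convex Ax Aa)) _.
exact: dir_derive_merit_le.
Qed.
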